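(* For every integer $a\ge 3$ and every positive integer $t\ge 2a^3+2a^2+1$, we have $\phi(t)\ge a$. Consequently, for every integer $t\ge 81$, $\phi(t)\ge\left\lfloor (t/3)^{1/3}\right\rfloor$. Furthermore, $\phi(t)=\Theta(t^{1/3})$.
   Context: For a $3$-element subset $T=\{a,b,c\}$ of a totally ordered set with $a<b<c$ and a $2$-element subset $e$, $[T:e]$ is $1$ if $e=\{a,b\}$ or $\{b,c\}$, $-1$ if $e=\{a,c\}$, $0$ if $e\not\subset T$. For a nonempty finite family $\mathcal T$ of $3$-element subsets of a totally ordered set, the support graph $\Gamma_0(\mathcal T)$ has vertex set $\bigcup_{T\in\mathcal T}T$ and edges the pairs contained in some member of $\mathcal T$; $\delta_{1,\mathcal T}$ is the $\mathcal T\times E(\Gamma_0(\mathcal T))$ matrix with entries $[T:e]$, and $\lambda(\mathcal T)$ is the smallest positive eigenvalue of $\delta_{1,\mathcal T}^T\delta_{1,\mathcal T}$. For positive integers $t$, $\phi(t)=\max_{|\mathcal T|=t}\lambda(\mathcal T)$. *)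

(* Defs.v *)
From HB Require Import structures.
From mathcomp Require Import all_boot all_order all_algebra.
From mathcomp Require Import finmap.
From mathcomp Require Import all_classical all_reals all_analysis.

Set Implicit Arguments.
Unset Strict Implicit.
Unset Printing Implicit Defensive.

Import Order.TTheory GRing.Theory Num.Theory.
Import numFieldNormedType.Exports.

Local Open Scope classical_set_scope.
Local Open Scope fset_scope.
Local Open Scope ring_scope.

(* Both default to 0 when the extremum is not attained. *)
Definition set_min (R : realType) (A : set R) : R := xget 0 (A `&` lbound A).
Definition set_max (R : realType) (A : set R) : R := xget 0 (A `&` ubound A).

Section SupportGraph.
Context {d : Order.disp_t} {V : orderType d}.

(* The symbol [T : e]; it is 0 when T does not have exactly three elements. *)
Definition incidence (R : realType) (T e : {fset V}) : R :=
  if sort <=%O (enum_fset T) is [:: a; b; c] then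
    if (e == [fset a; b]) || (e == [fset b; c]) then 1
    else if e == [fset a; c] then -1
    else 0
  else 0.

Definition support_edges (F : {fset {fset V}}) : {fset {fset V}} :=
  [fset e in \bigcup_(T <- F) fpowerset T | #|` e| == 2%N].

(* Rows and columns follow the enumerations of F and of its support edges;
   another choice only permutes the rows and columns. *)
Definition delta1 (R : realType) (F : {fset {fset V}}) :
    'M[R]_(#|` F|, #|` support_edges F|) :=
  \matrix_(i, j) incidence R (nth fset0 (enum_fset F) i)
                             (nth fset0 (enum_fset (support_edges F)) j).

Definition up_laplacian (R : realType) (F : {fset {fset V}}) :
    'M[R]_#|` support_edges F| :=
  (delta1 R F)^T *m delta1 R F.

Definition lambda (R : realType) (F : {fset {fset V}}) : R :=
  set_min [set x : R | 0 < x /\ eigenvalue (up_laplacian R F) x].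

Definition three_uniform (F : {fset {fset V}}) : Prop :=
  forall T : {fset V}, T \in F -> #|` T| = 3%N.

End SupportGraph.

Definition lambda_values (R : realType) (t : nat) : set R :=
  [set x | exists (d : Order.disp_t) (V : orderType d) (F : {fset {fset V}}),
     [/\ three_uniform F, #|` F| = t & x = lambda R F]].
Arguments lambda_values : clear implicits.

Definition phi (R : realType) (t : nat) : R := set_max (lambda_values R t).

(* Main.v *)
Require Import Defs.
From HB Require Import structures.
From mathcomp Require Import all_boot all_order all_algebra.
From mathcomp Require Import finmap spectral sesquilinear complex.
From mathcomp Require Import all_classical all_reals all_analysis.
From mathcomp Require Import zify ring lra.
Import Order.TTheory GRing.Theory Num.Theory.
Import numFieldNormedType.Exports.

(* Lower bound.  Put n = a + m and let F consist of all triples of n points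
   except some of those inside a fixed m-point set B.  A vector v in the row
   space of delta1 is an antisymmetric function f on pairs with zero divergence,
   and summing (f x y + f y z + f z x)^2 over all triples gives n |v|^2, whereas
   the triples inside B contribute at most m |v|^2.  Hence every positive
   eigenvalue is at least n - m = a.  The sizes of such F fill the interval
   from C(a+m,3) - C(m,3) to C(a+m,3); for m >= a + 3 consecutive intervals
   leave no gap, and the first one starts below 2a^3 + 2a^2 + 1.

   Upper bound.  The trace of the Laplacian is 3t, so lambda * rank <= 3t.
   Writing triples as a < b < c, the rank is at least the number of distinct
   pairs (a,b), of pairs (b,c) and of pairs (a,c), since for each kind the
   corresponding boundaries are triangular.  The Loomis-Whitney inequality
   yields t^2 <= rank^3, hence lambda^3 <= 27 t.

   The maximum phi is attained because for given t there are finitely many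
   matrices delta1. *)

Set Implicit Arguments.
Unset Strict Implicit.
Unset Printing Implicit Defensive.

(** * Finite labellings and the Loomis-Whitney inequality *)

(** Vertices live in an arbitrary ordered type, but [loomis_whitney] needs finite label types. Each
    value of [g] is therefore represented by a chosen index attaining it. *)
Lemma exists_finite_labelling (I : finType) (V : eqType) (g : I -> V) :
  exists h : I -> I, forall i j, (h i == h j) = (g i == g j).
Proof.
pose h i := odflt i [pick j | g j == g i].
have hE i : g (h i) = g i.
  by rewrite /h; case: pickP => [j /eqP //|/(_ i)]; rewrite eqxx.
exists h => i j; apply/eqP/eqP => [hij|gij]; first by rewrite -hE hij hE.
by rewrite /h gij; case: pickP => [//|/(_ j)]; rewrite eqxx.
Qed.

(** Multiply the two hypotheses and apply AM-GM to [x * v] and [u * y]. This is the Cauchy-Schwarz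
    step of [loomis_whitney], stated for naturals to avoid square roots. *)
Lemma sqr_leq_mul_cross (N f g x y u v : nat) :
  f ^ 2 <= N * (x * y) -> g ^ 2 <= N * (u * v) ->
  2 * (f * g) <= N * (x * v + u * y).
Proof.
move=> hf hg; rewrite -leq_sqr.
have h := leq_mul hf hg.
have -> : (2 * (f * g)) ^ 2 = 4 * (f ^ 2 * g ^ 2) by lia.
apply: (@leq_trans (N ^ 2 * (4 * ((x * v) * (u * y))))); first by lia.
rewrite expnMn leq_mul2l; apply/orP; right.
exact: nat_AGM2.
Qed.

(** Slice along [z]. By injectivity a fibre of size [f c] satisfies both [f c <= N] and
    [f c <= X c * Y c], so [f c ^ 2 <= N * (X c * Y c)]. Cauchy-Schwarz over the slices then bounds
    the square of the sum of the [f c]. *)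
Lemma loomis_whitney (I W : finType) (x y z : I -> W) :
  injective (fun i => (x i, y i, z i)) ->
  #|I| ^ 2 <= #|[set (x i, y i) | i : I]| *
              (#|[set (x i, z i) | i : I]| * #|[set (y i, z i) | i : I]|).
Proof.
move=> inj; set N := #|[set (x i, y i) | i : I]|.
pose fib c := [set i | z i == c].
pose f c := #|fib c|; pose X c := #|x @: fib c|; pose Y c := #|y @: fib c|.
have fibinj c : {in fib c &, injective (fun i => (x i, y i))}.
  move=> i j; rewrite !inE => /eqP zi /eqP zj [xij yij]; apply: inj.
  by rewrite xij yij zi zj.
have fN c : f c <= N.
  rewrite /f -(card_in_imset (@fibinj c)) subset_leq_card //.
  by apply/fintype.subsetP => p /imsetP[i _ ->]; apply: imset_f.
have fXY c : f c <= X c * Y c.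
  rewrite /f -(card_in_imset (@fibinj c)) -cardsX subset_leq_card //.
  by apply/fintype.subsetP => p /imsetP[i hi ->]; rewrite inE /= !imset_f.
have fE : #|I| = \sum_c f c.
  rewrite -sum1_card (partition_big z xpredT) //=; apply: eq_bigr => c _.
  by rewrite sum1dep_card.
have proj (g : I -> W) : \sum_c #|g @: fib c| <= #|[set (g i, z i) | i : I]|.
  rewrite -[leqRHS]sum1_card (partition_big snd xpredT) //=.
  apply: leq_sum => c _; rewrite sum1dep_card.
  rewrite -(card_imset (g @: fib c) (_ : injective (fun a => (a, c)))).
    apply/subset_leq_card/fintype.subsetP => p /imsetP[a ga ->].
    have /imsetP[i hi ->] := ga.
    have /eqP zi : z i == c by move: hi; rewrite inE.
    rewrite inE /= eqxx andbT -zi.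
    exact: (imset_f (fun i => (g i, z i))).
  by move=> a b [].
apply: (@leq_trans (N * ((\sum_c X c) * (\sum_c Y c)))); last first.
  by rewrite leq_mul // leq_mul // proj.
have cross c e : 2 * (f c * f e) <= N * (X c * Y e + X e * Y c).
  by apply: sqr_leq_mul_cross; rewrite expnS expn1 leq_mul.
(* The factor 2 is there because [cross] bounds [2 * (f c * f e)]; summed over all pairs [(c, e)],
   its two right-hand terms contribute equally. *)
suff : 2 * #|I| ^ 2 <= 2 * (N * ((\sum_c X c) * (\sum_c Y c))) by lia.
have sumE (g h : W -> nat) :
    (\sum_c g c) * (\sum_c h c) = \sum_c \sum_e g c * h e.
  by rewrite big_distrl /=; apply: eq_bigr => c _; rewrite big_distrr.
apply: (@leq_trans (\sum_c \sum_e N * (X c * Y e + X e * Y c))).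
  rewrite fE expnS expn1 sumE big_distrr leq_sum //= => c _.
  by rewrite big_distrr leq_sum.
apply/eq_leq.
under eq_bigr do rewrite -big_distrr /= big_split /=.
rewrite -big_distrr /= big_split /= [X in _ + X]exchange_big /= -sumE.
by rewrite mulnCA mul2n addnn.
Qed.

Local Open Scope ring_scope.

(** * Gram matrices: rank, eigenvalues and trace *)

Lemma mulmx_tr_ge0 (R : realDomainType) (n : nat) (v : 'rV[R]_n) :
  0 <= (v *m v^T) 0 0.
Proof. by rewrite mxE sumr_ge0 // => j _; rewrite mxE -expr2 sqr_ge0. Qed.

Lemma mulmx_tr_eq0 (R : realDomainType) (n : nat) (v : 'rV[R]_n) :
  ((v *m v^T) 0 0 == 0) = (v == 0).
Proof.
apply/eqP/eqP => [/eqP|->]; last by rewrite mul0mx mxE.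
rewrite mxE psumr_eq0 => [/allP v0|j _]; last by rewrite mxE -expr2 sqr_ge0.
apply/rowP => j; have := v0 j (mem_index_enum _).
by rewrite !mxE -expr2 sqrf_eq0 => /eqP.
Qed.

Lemma mxrank_gram (F : realFieldType) (p q : nat) (A : 'M[F]_(p, q)) :
  \rank (A^T *m A) = \rank A.
Proof.
apply/eqP; rewrite eqn_leq mxrankM_maxr /=.
(* If [v A^T A = 0] then [|v A^T|^2 = 0], so the kernels agree and so do the ranks. *)
have sub : (kermx (A^T *m A) <= kermx A^T)%MS.
  apply/rV_subP => v; rewrite !sub_kermx => /eqP h.
  by rewrite -mulmx_tr_eq0 trmx_mul trmxK mulmxA -(mulmxA v) h mul0mx mxE.
have := mxrankS sub; rewrite !mxrank_ker mxrank_tr.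
have := rank_leq_col A; have := rank_leq_row (A^T *m A).
lia.
Qed.

Lemma eigenvalue_gram_ge0 (F : realFieldType) (p q : nat) (A : 'M[F]_(p, q))
    (x : F) :
  eigenvalue (A^T *m A) x -> 0 <= x.
Proof.
move=> /eigenvalueP[v vA v0].
have vv : 0 < (v *m v^T) 0 0 by rewrite lt0r mulmx_tr_eq0 v0 mulmx_tr_ge0.
rewrite -(pmulr_lge0 _ vv).
have -> : x * (v *m v^T) 0 0 = ((v *m A^T) *m (v *m A^T)^T) 0 0.
  by rewrite trmx_mul trmxK mulmxA -(mulmxA v) vA -scalemxAl [RHS]mxE.
exact: mulmx_tr_ge0.
Qed.

(* An eigenvector of a positive eigenvalue lies in the row space of [A]. *)
Lemma pos_eigenvalue_gram_ge (F : realFieldType) (p q : nat)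
    (A : 'M[F]_(p, q)) (l x : F) :
  (forall y : 'rV_p, let v := y *m A in
     l * (v *m v^T) 0 0 <= ((v *m A^T) *m (v *m A^T)^T) 0 0) ->
  0 < x -> eigenvalue (A^T *m A) x -> l <= x.
Proof.
move=> hl x0 /eigenvalueP[v vA v0].
have vv : 0 < (v *m v^T) 0 0 by rewrite lt0r mulmx_tr_eq0 v0 mulmx_tr_ge0.
have vE : (x^-1 *: (v *m A^T)) *m A = v.
  by rewrite -scalemxAl -mulmxA vA scalerA mulVf ?scale1r // gt_eqF.
have := hl (x^-1 *: (v *m A^T)); rewrite /= vE.
rewrite [in leRHS]trmx_mul trmxK mulmxA -(mulmxA v) vA -scalemxAl.
by rewrite [leRHS]mxE ler_pM2r.
Qed.

Lemma mxrank_diag_le (F : fieldType) (n : nat) (d : 'rV[F]_n) :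
  (\rank (diag_mx d) <= #|[pred j | d 0%R j != 0%R]|)%N.
Proof.
rewrite diag_mx_sum_delta -sum1_card [leqRHS]big_mkcond /=.
apply: (big_ind2 (fun (M : 'M[F]_n) k => \rank M <= k)%N) => [|M k N l hM hN|j _].
- by rewrite mxrank0.
- by rewrite (leq_trans (mxrank_add _ _)) // leq_add.
rewrite inE; case: eqP => [->|/eqP d0]; first by rewrite scale0r mxrank0.
by rewrite (eqmx_scale _ d0) mxrank_delta.
Qed.

(** The real symmetric matrix is Hermitian over the complex extension of [R], where the spectral
    theorem diagonalises it with real entries. The family [d] lists eigenvalues with multiplicity,
    which is what the trace and rank statements require. *)
Lemma gram_spectrum (R : rcfType) (p q : nat) (A : 'M[R]_(p, q)) :
  exists d : 'I_q -> R,
    [/\ forall j, eigenvalue (A^T *m A) (d j),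
        \sum_j d j = \tr (A^T *m A)
      & (\rank A <= #|[pred j | d j != 0%R]|)%N].
Proof.
set M := A^T *m A.
pose C := map_mx (real_complex R) M.
have Cherm : C \is hermsymmx.
  apply: realsym_hermsym.
    apply/is_hermitianmxP; rewrite expr0 scale1r map_mx_id //.
    by rewrite /C map_trmx /M trmx_mul trmxK.
  by apply/mxOverP => i j; rewrite mxE complex_real.
have Creal := hermitian_spectral_diag_real Cherm.
have /hermitian_normalmx/orthomx_spectralP CE := Cherm.
set P := spectralmx C in CE; set D := spectral_diag C in Creal CE.
have Pu : P \in unitmx := spectral_unit C.
have DE j : real_complex R (complex.Re (D 0 j)) = D 0 j.
  by move/mxOverP: Creal => /(_ 0 j) /RRe_real.
exists (fun j => complex.Re (D 0 j)); split.
- move=> j; rewrite -(eigenvalue_map (real_complex R)) /= -/C DE.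
  (* Since [C] is [P^-1 D P], the rows of [P] are left eigenvectors; they are nonzero because [P] is
     invertible. *)
  apply/eigenvalueP; exists (row j P).
    rewrite -row_mul [in X in row _ (_ *m X)]CE -mulmxA mulKVmx ?Pu //.
    by rewrite row_mul row_diag_mx -scalemxAl -rowE.
  rewrite rowE; apply/eqP => /(congr1 (mulmx^~ (invmx P))).
  rewrite mulmxK // mul0mx => /matrixP/(_ 0 j).
  by rewrite !mxE !eqxx => /eqP; rewrite oner_eq0.
- apply: (fmorph_inj (real_complex R)); rewrite rmorph_sum /=.
  transitivity (\tr C); last by rewrite -trace_map_mx.
  rewrite CE mxtrace_mulC mulmxA mulmxV // mul1mx mxtrace_diag.
  by apply: eq_bigr => j _; rewrite DE.
- rewrite -mxrank_gram -(mxrank_map (real_complex R)) -/C CE.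
  rewrite (leq_trans (mxrankM_maxl _ _)) // (leq_trans (mxrankM_maxr _ _)) //.
  rewrite (leq_trans (mxrank_diag_le _)) //.
  by apply/eq_leq/eq_card => j; rewrite !inE -DE fmorph_eq0.
Qed.

Lemma mxtrace_gram (F : pzRingType) (p q : nat) (A : 'M[F]_(p, q)) :
  \tr (A^T *m A) = \sum_i \sum_j A i j * A i j.
Proof.
rewrite exchange_big; apply: eq_bigr => j _; rewrite mxE.
by apply: eq_bigr => i _; rewrite mxE.
Qed.

Lemma exists_pos_eigenvalue_gram (R : rcfType) (p q : nat) (A : 'M[R]_(p, q)) :
  A != 0 -> exists2 x, 0 < x & eigenvalue (A^T *m A) x.
Proof.
move=> A0; have [d [dE _ rk]] := gram_spectrum A.
have : (0 < #|[pred j | d j != 0%R]|)%N.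
  by rewrite (leq_trans _ rk) // lt0n mxrank_eq0.
case/card_gt0P => j; rewrite inE => dj; exists (d j) => //.
by rewrite lt0r dj (eigenvalue_gram_ge0 (dE j)).
Qed.

(** The trace is a sum of nonnegative eigenvalues, of which at least [\rank A] are nonzero and hence
    at least [l]. *)
Lemma pos_eigenvalue_mul_rank_le (R : rcfType) (p q : nat) (A : 'M[R]_(p, q))
    (l : R) :
  (forall x, 0 < x -> eigenvalue (A^T *m A) x -> l <= x) -> 0 <= l ->
  l * (\rank A)%:R <= \tr (A^T *m A).
Proof.
move=> hl l0; have [d [dE <- rk]] := gram_spectrum A.
have d0 j := eigenvalue_gram_ge0 (dE j).
apply: (@le_trans _ _ (l * #|[pred j | d j != 0]|%:R)).
  by rewrite ler_wpM2l // ler_nat.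
rewrite mulr_natr -sumr_const big_mkcond /= ler_sum // => j _.
by rewrite inE; case: eqP => //= /eqP dj; rewrite hl // lt0r dj d0.
Qed.

(* Triangularity: a nonzero combination of the chosen rows is detected by the
   pivot column of a row of maximal key in its support. *)
Lemma card_labels_le_rank (F : fieldType) (p q : nat) (A : 'M[F]_(p, q))
    (L : finType) (lab : 'I_p -> L) (piv : 'I_p -> 'I_q)
    (disp : Order.disp_t) (K : orderType disp) (key : 'I_p -> K) :
  (forall i, A i (piv i) != 0) ->
  (forall i i', A i' (piv i) != 0 -> lab i' != lab i -> (key i < key i')%O) ->
  (#|[set lab i | i : 'I_p]| <= \rank A)%N.
Proof.
move=> Apiv Akey; set S := [set lab i | i : 'I_p].
have [r rE] : exists r : 'I_#|S| -> 'I_p, forall k, lab (r k) = enum_val k.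
  apply: (@fin_all_exists _ (fun=> 'I_p) (fun k i => lab i = enum_val k)) => k.
  by have /imsetP[i _ ->] := enum_valP k; exists i.
have rinj k k' : lab (r k) = lab (r k') -> k = k'.
  by rewrite !rE => /enum_val_inj.
suff fr : row_free (rowsub r A).
  by rewrite -(eqP fr); apply/mxrankS/row_subP => k; rewrite row_rowsub row_sub.
rewrite -kermx_eq0; apply/rowV0P => y; rewrite sub_kermx => /eqP yA.
apply/eqP/contraT => /rV0Pn[k0 yk0].
have [k yk kmax] := @arg_maxP _ _ _ k0 (fun k => y 0 k != 0) (key \o r) yk0.
have /matrixP/(_ 0 (piv (r k))) := yA.
rewrite !mxE (bigD1 k) //= big1 ?addr0 => [/eqP|k' kk'].
  by rewrite mxE mulf_eq0 (negPf yk) (negPf (Apiv _)).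
rewrite mxE; apply/eqP; rewrite mulf_eq0; apply/contraT.
rewrite negb_or => /andP[yk' Ak'].
have /= := kmax _ yk'; rewrite leNgt /= Akey //.
by apply: contra kk' => /eqP/rinj->.
Qed.

Local Open Scope classical_set_scope.
Local Open Scope fset_scope.
Local Open Scope ring_scope.

(** * Extrema of finite sets and finiteness of the spectrum *)

Lemma finite_set_has_max (R : realType) (A : set R) :
  finite_set A -> A !=set0 -> exists x, (A `&` ubound A)%classic x.
Proof.
move=> /finite_fsetP[X ->] [x0 /= x0X].
have [x xX xmax] := @arg_maxP _ _ X [` x0X] xpredT val isT.
exists (val x); split => [|y /= yX]; first exact: valP.
exact: (xmax [` yX]).
Qed.

Lemma finite_set_has_min (R : realType) (A : set R) :
  finite_set A -> A !=set0 -> exists x, (A `&` lbound A)%classic x.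
Proof.
move=> /finite_fsetP[X ->] [x0 /= x0X].
have [x xX xmin] := @arg_minP _ _ X [` x0X] xpredT val isT.
exists (val x); split => [|y /= yX]; first exact: valP.
exact: (xmin [` yX]).
Qed.

Lemma finite_eigenvalues (R : realType) (n : nat) (M : 'M[R]_n) :
  finite_set [set x | eigenvalue M x].
Proof.
apply: contrapT => /(infinite_set_fset n.+1)[B Bsub Bn].
have cp0 : char_poly M != 0 by rewrite monic_neq0 ?char_poly_monic.
have : all (root (char_poly M)) B.
  by apply/allP => x xB; rewrite -eigenvalue_root_char; apply: Bsub.
move=> /(max_poly_roots cp0)/(_ (fset_uniq B)).
by rewrite size_char_poly ltnNge Bn.
Qed.

(** * Coordinates for the coboundary matrix of a family of triples *)

Section SupportFamily.
Context {disp : Order.disp_t} {V : orderType disp}.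
Implicit Types (F : {fset {fset V}}) (T e : {fset V}) (a b c x y z : V).

Lemma fset2_eq a b x y : (a < b)%O -> (x < y)%O ->
  ([fset a; b] == [fset x; y]) = (a == x) && (b == y).
Proof.
move=> ab xy; apply/eqP/andP => [/fsetP E|[/eqP-> /eqP->] //].
suff [-> ->] : [:: a; b] = [:: x; y] by [].
apply: lt_sorted_eq; rewrite /= ?ab ?xy // => u.
by have := E u; rewrite !inE.
Qed.

Lemma fset3_eq a b c x y z : (a < b)%O -> (b < c)%O -> (x < y)%O -> (y < z)%O ->
  ([fset a; b; c] == [fset x; y; z]) = [&& a == x, b == y & c == z].
Proof.
move=> ab bc xy yz.
apply/eqP/and3P => [/fsetP E|[/eqP-> /eqP-> /eqP->] //].
suff [-> -> ->] : [:: a; b; c] = [:: x; y; z] by [].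
apply: lt_sorted_eq; rewrite /= ?ab ?bc ?xy ?yz // => u.
by have := E u; rewrite !inE -!orbA.
Qed.

Lemma cardfs2_sort e : #|` e| = 2%N ->
  exists a b, (a < b)%O /\ sort <=%O (enum_fset e) = [:: a; b].
Proof.
move=> e2; have : size (sort <=%O e) = 2%N by rewrite size_sort.
have := sort_lt_sorted (enum_fset e); rewrite fset_uniq.
case: (sort _ _) => [|a [|b []]] //= /andP[ab _] _.
by exists a, b.
Qed.

Lemma cardfs3_sort T : #|` T| = 3%N ->
  exists t : V * V * V, let: (a, b, c) := t in
  [/\ (a < b)%O, (b < c)%O & sort <=%O (enum_fset T) = [:: a; b; c]].
Proof.
move=> T3; have : size (sort <=%O T) = 3%N by rewrite size_sort.
have := sort_lt_sorted (enum_fset T); rewrite fset_uniq.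
case: (sort _ _) => [|a [|b [|c []]]] //= /and3P[ab bc _] _.
by exists (a, b, c).
Qed.

Lemma in_support_edges F T e :
  T \in F -> e `<=` T -> #|` e| = 2%N -> e \in support_edges F.
Proof.
move=> TF eT e2; rewrite !inE /= e2 eqxx andbT.
by apply/bigfcupP; exists T; rewrite ?TF // fpowersetE.
Qed.

(** Replaces the sorting in [incidence] by explicit data: the ordered vertices of each triple and
    the column indices of its three edges. All later arguments about [delta1] go through this
    form. *)
Lemma three_uniform_delta1 (R : realType) F : three_uniform F ->
  exists (a b c : 'I_#|` F| -> V)
    (ab bc ac : 'I_#|` F| -> 'I_#|` support_edges F|),
  let E (j : 'I_#|` support_edges F|) := nth fset0 (enum_fset (support_edges F)) j in
  [/\ forall i, (a i < b i)%O /\ (b i < c i)%O,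
      forall i : 'I_#|` F|, nth fset0 (enum_fset F) i = [fset a i; b i; c i],
      forall i, [/\ E (ab i) = [fset a i; b i], E (bc i) = [fset b i; c i]
                  & E (ac i) = [fset a i; c i]],
      forall i, [/\ ab i != bc i, ac i != ab i & ac i != bc i]
    & forall i j, delta1 R F i j =
        (j == ab i)%:R + (j == bc i)%:R - (j == ac i)%:R].
Proof.
move=> F3; set E := fun j : 'I_#|` support_edges F| => _.
pose T (i : 'I_#|` F|) := nth fset0 (enum_fset F) i.
have TF i : T i \in F by apply: mem_nth.
have [t tE] : exists t : 'I_#|` F| -> V * V * V, forall i,
    let: (a, b, c) := t i in
    [/\ (a < b)%O, (b < c)%O & sort <=%O (enum_fset (T i)) = [:: a; b; c]].
  apply: (@fin_all_exists _ (fun=> (V * V * V)%type) (fun i (u : V * V * V) =>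
    let: (a, b, c) := u in
    [/\ (a < b)%O, (b < c)%O & sort <=%O (enum_fset (T i)) = [:: a; b; c]])).
  by move=> i; apply: cardfs3_sort; apply: F3.
pose a i := (t i).1.1; pose b i := (t i).1.2; pose c i := (t i).2.
have {}tE i : [/\ (a i < b i)%O, (b i < c i)%O
    & sort <=%O (enum_fset (T i)) = [:: a i; b i; c i]].
  by rewrite /a /b /c; have := tE i; case: (t i) => [[? ?] ?].
have ltab i : (a i < b i)%O by have [] := tE i.
have ltbc i : (b i < c i)%O by have [] := tE i.
have ltac i : (a i < c i)%O := lt_trans (ltab i) (ltbc i).
have TE i : T i = [fset a i; b i; c i].
  apply/fsetP => x; have [_ _ s] := tE i.
  by rewrite -(mem_sort <=%O) s !inE orbA.
have idx (f g : 'I_#|` F| -> V) :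
    (forall i, (f i < g i)%O) -> (forall i, [fset f i; g i] `<=` T i) ->
    exists j : 'I_#|` F| -> 'I_#|` support_edges F|,
      forall i, E (j i) = [fset f i; g i].
  move=> fg fgT; apply: (@fin_all_exists _ (fun=> 'I_#|` support_edges F|)
    (fun i k => E k = [fset f i; g i])) => i.
  have /(nthP fset0)[k kq kE] : [fset f i; g i] \in enum_fset (support_edges F).
    apply: (in_support_edges (TF i)) => //.
    by rewrite cardfs2 lt_eqF.
  by exists (Ordinal kq).
have [||ab abE] := idx a b => //.
  by move=> i; apply/fsubsetP => x; rewrite TE !inE => /orP[]->; rewrite ?orbT.
have [||bc bcE] := idx b c => //.
  by move=> i; apply/fsubsetP => x; rewrite TE !inE => /orP[]->; rewrite ?orbT.
have [||ac acE] := idx a c => //.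
  by move=> i; apply/fsubsetP => x; rewrite TE !inE => /orP[]->; rewrite ?orbT.
have Eeq (j k : 'I_#|` support_edges F|) : (j == k) = (E j == E k).
  by rewrite /E nth_uniq ?fset_uniq.
have ne i : [/\ ab i != bc i, ac i != ab i & ac i != bc i].
  rewrite !Eeq abE bcE acE !fset2_eq // eqxx /=.
  by rewrite [a i == b i]lt_eqF // [c i == b i]gt_eqF.
exists a, b, c, ab, bc, ac; split => // i j.
rewrite mxE -/(E j) -/(T i) /incidence; have [_ _ ->] := tE i.
have [ne1 ne2 ne3] := ne i.
rewrite -abE -bcE -acE -!Eeq.
case: (eqVneq j (ab i)) => [->|jab] /=.
  by rewrite (negPf ne1) eq_sym (negPf ne2) subr0 addr0.
case: (eqVneq j (bc i)) => [->|jbc] /=.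
  by rewrite eq_sym (negPf ne3) subr0 add0r.
by case: eqP; rewrite !add0r ?oppr0.
Qed.

(** Rules out the default value 0 of [set_min]: the set of positive eigenvalues is finite, and it is
    nonempty because [delta1] has an entry -1 in any row. *)
Lemma lambda_spec (R : realType) F : three_uniform F -> (0 < #|` F|)%N ->
  let S := [set x : R | 0 < x /\ eigenvalue (up_laplacian R F) x] in
  S (lambda R F) /\ lbound S (lambda R F).
Proof.
move=> F3 F0 S; apply: (@xgetPex _ _ (S `&` lbound S)%classic).
apply: finite_set_has_min.
  by apply: sub_finite_set (finite_eigenvalues (up_laplacian R F)) => x [].
have [a [b [c [ab [bc [ac [_ _ _ ne dE]]]]]]] := three_uniform_delta1 R F3.
have [|x x0 ex] := @exists_pos_eigenvalue_gram R _ _ (delta1 R F); last by exists x.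
pose i := Ordinal F0.
apply/eqP => /matrixP/(_ i (ac i)); rewrite dE mxE.
have [_ /negPf-> /negPf->] := ne i.
by rewrite eqxx !add0r => /eqP; rewrite oppr_eq0 oner_eq0.
Qed.

(** * Upper bound on lambda from trace and rank *)

Lemma mxtrace_up_laplacian (R : realType) F : three_uniform F ->
  \tr (up_laplacian R F) = 3 * #|` F|%:R.
Proof.
move=> F3; have [a [b [c [ab [bc [ac [_ _ _ ne dE]]]]]]] :=
  three_uniform_delta1 R F3.
rewrite mxtrace_gram (eq_bigr (fun=> 3)) => [|i _].
  by rewrite sumr_const card_ord mulr_natr.
have [n1 n2 n3] := ne i.
rewrite (bigD1 (ab i)) //= (bigD1 (bc i)) 1?eq_sym //= (bigD1 (ac i)) /=; last first.
  by rewrite n2 n3.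
rewrite big1 => [|j /andP[/andP[j1 j2] j3]]; last first.
  by rewrite dE (negPf j1) (negPf j2) (negPf j3) !addr0 subr0 mul0r.
rewrite !dE !eqxx [bc i == ab i]eq_sym [ab i == ac i]eq_sym.
rewrite [bc i == ac i]eq_sym (negPf n1) (negPf n2) (negPf n3) /=.
ring.
Qed.

(* For each of the three kinds of edges of a triple, the boundaries of triples
   with distinct edges of that kind are triangular for a lexicographic order. *)
Lemma card_sqr_le_rank_delta1_cube (R : realType) F : three_uniform F ->
  (#|` F| ^ 2 <= \rank (delta1 R F) ^ 3)%N.
Proof.
move=> F3; have [a [b [c [ab [bc [ac [lt TE Ee ne dE]]]]]]] :=
  three_uniform_delta1 R F3.
have [f fE] := exists_finite_labelling a.
have [g gE] := exists_finite_labelling b.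
have [h hE] := exists_finite_labelling c.
have ltab i : (a i < b i)%O by case: (lt i).
have ltbc i : (b i < c i)%O by case: (lt i).
have ltac i : (a i < c i)%O := lt_trans (ltab i) (ltbc i).
have inj : injective (fun i => (f i, g i, h i)).
  move=> i j [/eqP + /eqP + /eqP].
  rewrite fE gE hE => /eqP ea /eqP eb /eqP ec; apply: val_inj => /=.
  apply/eqP; rewrite -(nth_uniq fset0 _ _ (fset_uniq F)) //.
  by rewrite !TE ea eb ec.
have support i j : delta1 R F i j != 0 -> [\/ j = ab i, j = bc i | j = ac i].
  rewrite dE; case: (eqVneq j (ab i)) => [->|_]; first by constructor 1.
  case: (eqVneq j (bc i)) => [->|_]; first by constructor 2.
  case: (eqVneq j (ac i)) => [->|_]; first by constructor 3.
  by rewrite !addr0 subr0 eqxx.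
have edge (p q u v : 'I_#|` F| -> V) (j k : 'I_#|` F| -> 'I__) i i' :
    (forall i, p i < q i)%O -> (forall i, u i < v i)%O ->
    (forall i, nth fset0 (enum_fset (support_edges F)) (j i) = [fset p i; q i]) ->
    (forall i, nth fset0 (enum_fset (support_edges F)) (k i) = [fset u i; v i]) ->
    j i = k i' -> p i = u i' /\ q i = v i'.
  move=> pq uv jE kE jk; have := jE i; rewrite jk kE => /esym/eqP.
  by rewrite fset2_eq // => /andP[/eqP-> /eqP->].
have abE i : nth fset0 (enum_fset (support_edges F)) (ab i) = [fset a i; b i].
  by case: (Ee i).
have bcE i : nth fset0 (enum_fset (support_edges F)) (bc i) = [fset b i; c i].
  by case: (Ee i).
have acE i : nth fset0 (enum_fset (support_edges F)) (ac i) = [fset a i; c i].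
  by case: (Ee i).
have piv i : [/\ delta1 R F i (ab i) != 0, delta1 R F i (bc i) != 0
                & delta1 R F i (ac i) != 0].
  have [n1 n2 n3] := ne i; rewrite !dE !eqxx (negPf n2) (negPf n3).
  rewrite [ab i == ac i]eq_sym [bc i == ac i]eq_sym [bc i == ab i]eq_sym.
  rewrite (negPf n1) (negPf n2) (negPf n3) !(addr0, add0r, subr0) oppr_eq0.
  by split; apply: oner_neq0.
(* If another triple [i'] meets the column of the edge [ab i], then either [a i = b i' > a i'], or
   [a i = a i'] and [b i = c i' > b i']. The key [(a, b)] thus drops, which explains the dual
   orders. *)
have rab : (#|[set (f i, g i) | i : 'I_#|` F|]| <= \rank (delta1 R F))%N.
  apply: (@card_labels_le_rank _ _ _ _ _ _ ab _ (V^d *l V^d)%type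
           (fun i => (a i, b i))) => [i|i i' /support E]; first by case: (piv i).
  rewrite xpair_eqE fE gE ltxi_pair !leEdual ltEdual.
  case: E.
  - by case/(edge _ _ _ _ _ _ _ _ _ ltab ltab abE abE) => -> ->; rewrite !eqxx.
  - case/(edge _ _ _ _ _ _ _ _ _ ltab ltbc abE bcE) => -> ->.
    by rewrite (ltW (ltab i')) leNgt ltab.
  - case/(edge _ _ _ _ _ _ _ _ _ ltab ltac abE acE) => -> ->.
    by rewrite lexx ltbc.
(* Here either [c i = b i' < c i'], or [c i = c i'] and [b i = a i' < b i'], so the key [(c, b)]
   increases. *)
have rbc : (#|[set (g i, h i) | i : 'I_#|` F|]| <= \rank (delta1 R F))%N.
  apply: (@card_labels_le_rank _ _ _ _ _ _ bc _ (V *l V)%type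
           (fun i => (c i, b i))) => [i|i i' /support E]; first by case: (piv i).
  rewrite xpair_eqE gE hE ltxi_pair; case: E.
  - case/(edge _ _ _ _ _ _ _ _ _ ltbc ltab bcE abE) => -> ->.
    by rewrite (ltW (ltbc i')) leNgt ltbc.
  - by case/(edge _ _ _ _ _ _ _ _ _ ltbc ltbc bcE bcE) => -> ->; rewrite !eqxx.
  - case/(edge _ _ _ _ _ _ _ _ _ ltbc ltac bcE acE) => -> ->.
    by rewrite lexx ltab.
(* Here either [a i = a i'] and [c i = b i' < c i'], or [a i = b i' > a i']; hence the order is dual
   in [a] only. *)
have rac : (#|[set (f i, h i) | i : 'I_#|` F|]| <= \rank (delta1 R F))%N.
  apply: (@card_labels_le_rank _ _ _ _ _ _ ac _ (V^d *l V)%type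
           (fun i => (a i, c i))) => [i|i i' /support E]; first by case: (piv i).
  rewrite xpair_eqE fE hE ltxi_pair !leEdual; case: E.
  - case/(edge _ _ _ _ _ _ _ _ _ ltac ltab acE abE) => -> ->.
    by rewrite lexx ltbc.
  - case/(edge _ _ _ _ _ _ _ _ _ ltac ltbc acE bcE) => -> ->.
    by rewrite (ltW (ltab i')) leNgt ltab.
  - by case/(edge _ _ _ _ _ _ _ _ _ ltac ltac acE acE) => -> ->; rewrite !eqxx.
have := loomis_whitney inj; rewrite card_ord => /leq_trans; apply.
by rewrite !expnS expn0 muln1 leq_mul // leq_mul.
Qed.

(** With [l * r <= 3 * t] and [t ^ 2 <= r ^ 3] one gets [l^3 t^2 <= l^3 r^3 <= 27 t^3], and [t^2]
    cancels. *)
Lemma lambda_cube_le (R : realType) F : three_uniform F -> (0 < #|` F|)%N ->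
  lambda R F ^+ 3 <= 27 * #|` F|%:R.
Proof.
move=> F3 F0; have [[l0 _] lmin] := lambda_spec R F3 F0.
have := @pos_eigenvalue_mul_rank_le R _ _ (delta1 R F) (lambda R F) _ (ltW l0).
rewrite [\tr _](mxtrace_up_laplacian R F3).
have := card_sqr_le_rank_delta1_cube R F3.
set l := lambda R F; set t := #|` F|; set r := \rank _ => tr h.
have lr : l * r%:R <= 3 * t%:R.
  by apply: h => x x0 ex; apply: lmin.
have t0 : 0 < t%:R :> R by rewrite ltr0n.
have lr3 : (l * r%:R) ^+ 3 <= (3 * t%:R) ^+ 3.
  by rewrite lerXn2r // nnegrE ?mulr_ge0 // ltW.
have tr' : t%:R ^+ 2 <= r%:R ^+ 3 :> R by rewrite -!natrX ler_nat.
rewrite -(ler_pM2r (exprn_gt0 2 t0)).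
apply: (@le_trans _ _ (l ^+ 3 * r%:R ^+ 3)).
  by rewrite ler_wpM2l // exprn_ge0 // ltW.
by rewrite -exprMn (le_trans lr3) // le_eqVlt; apply/orP; left; apply/eqP; ring.
Qed.

(** * Finitely many values of lambda, and the maximum phi *)

(** A triple has 8 subsets; this crude count suffices, since it only serves to bound the number of
    columns. *)
Lemma card_support_edges_le F : three_uniform F ->
  (#|` support_edges F| <= 8 * #|` F|)%N.
Proof.
move=> F3; apply: (@leq_trans #|` \bigcup_(T <- F) fpowerset T|).
  by apply/fsubset_leq_card/fsubsetP => e; rewrite !inE => /andP[].
have {}F3 : {in enum_fset F, forall T, #|` T| = 3%N} by move=> T; apply: F3.
rewrite /= -[#|` F|]/(size (enum_fset F)).
elim: (enum_fset F) F3 => [|T s IH] F3; first by rewrite big_nil cardfs0.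
rewrite big_cons (leq_trans (leq_card_fsetU _ _)) //= mulnS leq_add //.
  by rewrite card_fpowerset F3 // mem_head.
by apply: IH => U Us; apply: F3; rewrite inE Us orbT.
Qed.

End SupportFamily.

(* The matrices [delta1 R F] with [#|` F| = t] have at most [8 t] columns and
   entries in {-1, 0, 1}, so they take finitely many values. *)
Lemma finite_lambda_values (R : realType) (t : nat) :
  finite_set (lambda_values R t).
Proof.
(* The index [k] in 0, 1, 2 encodes the entry [k - 1]; [D] collects the encoded matrices of every
   admissible width. *)
pose entry (k : 'I_3) : R := (k%:Z - 1)%:~R.
pose D := {q : 'I_(8 * t).+1 & 'M['I_3]_(t, q)}.
pose val (s : D) : R := let A := map_mx entry (tagged s) in
  set_min [set x : R | 0 < x /\ eigenvalue (A^T *m A) x].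
apply: (@sub_finite_set _ _ (range val)); last exact/finite_image/(@finite_finset D).
move=> _ [d [V [F [F3 Ft ->]]]]; subst t.
have qE : (#|` support_edges F| < (8 * #|` F|).+1)%N.
  by rewrite ltnS card_support_edges_le.
have [a [b [c [ab [bc [ac [_ _ _ ne dE]]]]]]] := three_uniform_delta1 R F3.
pose B : 'M['I_3]_(#|` F|, Ordinal qE) := \matrix_(i, j)
  if (j == ab i) || (j == bc i) then inord 2 else
  if j == ac i then inord 0 else inord 1.
exists (Tagged (fun q : 'I__ => 'M['I_3]_(#|` F|, q)) B) => //.
rewrite /val /= /lambda /up_laplacian.
suff -> : map_mx entry B = delta1 R F by [].
apply/matrixP => i j; rewrite dE !mxE /entry.
have [n1 n2 n3] := ne i.
case: (eqVneq j (ab i)) => [->|_] /=.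
  by rewrite inordK // [_ == ac i]eq_sym (negPf n1) (negPf n2) addr0 subr0.
case: (eqVneq j (bc i)) => [->|_] /=.
  by rewrite inordK // [_ == ac i]eq_sym (negPf n3) add0r subr0.
case: (eqVneq j (ac i)) => _ /=; rewrite inordK //.
  by rewrite !add0r.
by rewrite !addr0 subr0.
Qed.

Lemma lambda_le_phi (R : realType) (d : Order.disp_t) (V : orderType d)
    (F : {fset {fset V}}) :
  three_uniform F -> lambda R F <= phi R #|` F|.
Proof.
move=> F3; have FV : lambda_values R #|` F| (lambda R F) by exists d, V, F.
have [|_] := @xgetPex _ (0 : R) (lambda_values R #|` F| `&`
    ubound (lambda_values R #|` F|))%classic; last exact.
by apply: finite_set_has_max; [exact: finite_lambda_values|exists (lambda R F)].
Qed.

Lemma phi_ge0_cube_le (R : realType) (t : nat) : (0 < t)%N ->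
  0 <= phi R t /\ phi R t ^+ 3 <= 27 * t%:R.
Proof.
move=> t0; rewrite /phi /set_max; case: xgetP => [x _ []|_]; last first.
  by rewrite expr0n /= mulr_ge0.
move=> [d [V [F [F3 Ft ->]]]] _; rewrite -Ft in t0 *.
have [[l0 _] _] := lambda_spec R F3 t0.
by split; [exact: ltW|exact: lambda_cube_le].
Qed.

(** * Lower bound on lambda for nearly complete families *)

(** Expand the square. The three square terms agree after cyclic renaming, and so do the three cross
    terms; by antisymmetry, summing [f x y * f y z] over [x] and [z] gives minus the squared
    weighted divergence at [y]. *)
Lemma weighted_triangle_sum (R : comPzRingType) (I : finType) (w : I -> R)
    (f : I -> I -> R) :
  (forall x y, f y x = - f x y) ->
  \sum_x \sum_y \sum_z w x * w y * w z * (f x y + f y z + f z x) ^+ 2 =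
  3 * (\sum_x w x) * (\sum_x \sum_y w x * w y * f x y ^+ 2) -
  6 * \sum_y w y * (\sum_x w x * f x y) ^+ 2.
Proof.
move=> fN.
pose Q := \sum_x \sum_y \sum_z w x * w y * w z * f x y ^+ 2.
pose P := \sum_x \sum_y \sum_z w x * w y * w z * (f x y * f y z).
have rot (g : I -> I -> I -> R) :
    \sum_x \sum_y \sum_z g y z x = \sum_x \sum_y \sum_z g x y z.
  by rewrite exchange_big; apply: eq_bigr => y _; rewrite exchange_big.
have QE : Q = (\sum_x w x) * (\sum_x \sum_y w x * w y * f x y ^+ 2).
  rewrite mulr_sumr; apply: eq_bigr => x _.
  rewrite mulr_sumr; apply: eq_bigr => y _.
  by rewrite mulr_suml; apply: eq_bigr => z _; ring.
have PE : P = - \sum_y w y * (\sum_x w x * f x y) ^+ 2.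
  rewrite /P exchange_big -sumrN; apply: eq_bigr => y _.
  rewrite expr2 -mulrN -mulrN mulr_suml mulr_sumr; apply: eq_bigr => x _.
  rewrite -sumrN mulr_sumr mulr_sumr; apply: eq_bigr => z _.
  by rewrite [f y z]fN; ring.
have -> : \sum_x \sum_y \sum_z w x * w y * w z * (f x y + f y z + f z x) ^+ 2 =
    (Q + \sum_x \sum_y \sum_z w y * w z * w x * f y z ^+ 2
       + \sum_x \sum_y \sum_z w z * w x * w y * f z x ^+ 2)
    + 2 * (P + \sum_x \sum_y \sum_z w y * w z * w x * (f y z * f z x)
       + \sum_x \sum_y \sum_z w z * w x * w y * (f z x * f x y)).
  rewrite -!big_split /= mulr_sumr -big_split; apply: eq_bigr => x _ /=.
  rewrite -!big_split /= mulr_sumr -big_split; apply: eq_bigr => y _ /=.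
  rewrite -!big_split /= mulr_sumr -big_split; apply: eq_bigr => z _ /=.
  by ring.
rewrite (rot (fun x y z => w x * w y * w z * f x y ^+ 2)).
rewrite (rot (fun x y z => w x * w y * w z * (f x y * f y z))).
rewrite -(rot (fun x y z => w z * w x * w y * f z x ^+ 2)).
rewrite -(rot (fun x y z => w z * w x * w y * (f z x * f x y))).
by rewrite -/Q -/P PE QE; ring.
Qed.

(** Triples with a repeated index contribute 0, and each increasing triple is met in its six
    orderings. *)
Lemma sum_sym3 (R : nmodType) (n : nat) (h : 'I_n -> 'I_n -> 'I_n -> R) :
  (forall x y z, h y x z = h x y z) -> (forall x y z, h x z y = h x y z) ->
  (forall x z, h x x z = 0) ->
  \sum_x \sum_y \sum_z h x y z =
  (\sum_(x < n) \sum_(y < n) \sum_(z < n) if (x < y < z)%N then h x y z else 0) *+ 6.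
Proof.
move=> s12 s23 h0; pose g (x y z : 'I_n) := if (x < y < z)%N then h x y z else 0.
have sw12 (u : 'I_n -> 'I_n -> 'I_n -> R) :
    \sum_x \sum_y \sum_z u y x z = \sum_x \sum_y \sum_z u x y z.
  by rewrite exchange_big.
have sw23 (u : 'I_n -> 'I_n -> 'I_n -> R) :
    \sum_x \sum_y \sum_z u x z y = \sum_x \sum_y \sum_z u x y z.
  by apply: eq_bigr => x _; rewrite exchange_big.
have -> : \sum_x \sum_y \sum_z h x y z = \sum_x \sum_y \sum_z
    (g x y z + g x z y + g y x z + g y z x + g z x y + g z y x).
  apply: eq_bigr => x _; apply: eq_bigr => y _; apply: eq_bigr => z _.
  have e1 : h x z y = h x y z by [].
  have e2 : h y x z = h x y z by [].
  have e3 : h y z x = h x y z by rewrite s23.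
  have e4 : h z x y = h x y z by rewrite s12.
  have e5 : h z y x = h x y z by rewrite s12 s23.
  rewrite /g e1 e2 e3 e4 e5.
  have [/val_inj E|/eqP xy] := eqVneq (x : nat) y.
    by rewrite E h0 !if_same !addr0.
  have [/val_inj E|/eqP yz] := eqVneq (y : nat) z.
    by rewrite -e3 E h0 !if_same !addr0.
  have [/val_inj E|/eqP xz] := eqVneq (x : nat) z.
    by rewrite -e1 E h0 !if_same !addr0.
  by do 6! [case: ifP => ?]; rewrite ?addr0 ?add0r //; lia.
under eq_bigr do under eq_bigr do rewrite !big_split /=.
under eq_bigr do rewrite !big_split /=.
rewrite !big_split /= (sw23 g) (sw12 g).
rewrite (sw12 (fun x y z => g x z y)) (sw12 (fun x y z => g z x y)).
rewrite (sw23 (fun x y z => g y x z)) (sw12 g) (sw23 g).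
by rewrite -[X in X *+ 6]/(\sum_x \sum_y \sum_z g x y z) 5!mulrSr mulr1n.
Qed.

Lemma ler_sum_injective (R : numDomainType) (I J : finType) (p : J -> I)
    (G : I -> R) :
  injective p -> (forall i, 0 <= G i) -> \sum_j G (p j) <= \sum_i G i.
Proof.
move=> pinj G0; rewrite (partition_big p xpredT) //= ler_sum // => i _.
rewrite (eq_bigr (fun=> G i)) => [|j /eqP-> //].
rewrite sumr_const -[leRHS]mulr1n ler_wpMn2l //.
by apply/card_le1_eqP => j k; rewrite !unfold_in => /eqP<- /eqP/pinj.
Qed.

Lemma ler_sum_cover (R : numDomainType) (I J : finType) (p : J -> I)
    (G : I -> R) :
  (forall i, 0 <= G i) -> (forall i, G i != 0 -> exists j, p j = i) ->
  \sum_i G i <= \sum_j G (p j).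
Proof.
move=> G0 cov; rewrite [leRHS](partition_big p xpredT) //= ler_sum // => i _.
rewrite (eq_bigr (fun=> G i)) => [|j /eqP-> //].
have [->|/cov[j ji]] := eqVneq (G i) 0; first by rewrite big1.
rewrite sumr_const -[leLHS]mulr1n ler_wpMn2l //.
by apply/card_gt0P; exists j; apply/eqP.
Qed.

Lemma delta1_row_space_ge (R : realType) (n : nat) (F : {fset {fset 'I_n}})
    (B : {set 'I_n}) (y : 'rV[R]_#|` F|) :
  three_uniform F ->
  (forall x y z : 'I_n, (x < y < z)%N ->
     ~~ [&& x \in B, y \in B & z \in B] -> [fset x; y; z] \in F) ->
  let v := y *m delta1 R F in
  (n%:R - #|B|%:R) * (v *m v^T) 0 0 <=
  ((v *m (delta1 R F)^T) *m (v *m (delta1 R F)^T)^T) 0 0.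
Proof.
move=> F3 FB.
have [a [b [c [ab [bc [ac [lt TE Ee ne dE]]]]]]] := three_uniform_delta1 R F3.
pose E (j : 'I_#|` support_edges F|) := nth fset0 (enum_fset (support_edges F)) j.
rewrite /=; set v := y *m _.
(* [o i] is the boundary cycle of triple [i] as an antisymmetric function on ordered pairs; [f]
   extends [v] to all ordered pairs in the same way. Cycles have zero divergence, hence [div0]. *)
pose o i (x z : 'I_n) : R :=
  (x == a i)%:R * (z == b i)%:R - (x == b i)%:R * (z == a i)%:R
  + ((x == b i)%:R * (z == c i)%:R - (x == c i)%:R * (z == b i)%:R)
  + ((x == c i)%:R * (z == a i)%:R - (x == a i)%:R * (z == c i)%:R).
pose f x z := \sum_i y 0 i * o i x z.
have fN x z : f z x = - f x z.
  by rewrite /f -sumrN; apply: eq_bigr => i _; rewrite /o; ring.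
have div0 z : \sum_x f x z = 0.
  rewrite exchange_big big1 //= => i _; rewrite -mulr_sumr.
  have s1 u : \sum_x (x == u)%:R = 1 :> R.
    by rewrite (bigD1 u) //= eqxx big1 ?addr0 // => x /negPf->.
  rewrite /o !big_split /= !sumrN -!mulr_suml !s1; ring.
have EE (j k : 'I_#|` support_edges F|) : (j == k) = (E j == E k).
  by rewrite /E nth_uniq ?fset_uniq.
have ltab i : (a i < b i)%O by case: (lt i).
have ltbc i : (b i < c i)%O by case: (lt i).
have ltac i : (a i < c i)%O := lt_trans (ltab i) (ltbc i).
have abE i : E (ab i) = [fset a i; b i] by case: (Ee i).
have bcE i : E (bc i) = [fset b i; c i] by case: (Ee i).
have acE i : E (ac i) = [fset a i; c i] by case: (Ee i).
have vE j x z : (x < z)%O -> E j = [fset x; z] -> v 0 j = f x z.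
  move=> xz jE; rewrite mxE; apply: eq_bigr => i _; congr (_ * _).
  rewrite dE !EE jE abE bcE acE !fset2_eq // /o.
  have rev u t : (u < t)%O -> (x == t)%:R * (z == u)%:R = 0 :> R.
    move=> ut; case: eqP => [xt|_]; last by rewrite mul0r.
    case: eqP => [zu|_]; last by rewrite mulr0.
    by move: xz; rewrite xt zu => /(lt_trans ut); rewrite ltxx.
  rewrite (rev _ _ (ltab i)) (rev _ _ (ltbc i)) (rev _ _ (ltac i)).
  by rewrite -!natrM !mulnb; ring.
have [p pE] : exists p : 'I_#|` support_edges F| -> 'I_n * 'I_n,
    forall j, ((p j).1 < (p j).2)%O /\ E j = [fset (p j).1; (p j).2].
  apply: (@fin_all_exists _ (fun=> ('I_n * 'I_n)%type) (fun j u =>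
    (u.1 < u.2)%O /\ E j = [fset u.1; u.2])) => j.
  have : E j \in support_edges F by apply: mem_nth.
  rewrite !inE => /andP[_ /eqP/cardfs2_sort[u [v0 [uv s]]]].
  exists (u, v0); split=> //; apply/fsetP => x.
  by rewrite -(mem_sort <=%O) s !inE.
have pinj : injective p.
  move=> j k jk; apply/eqP; rewrite EE.
  by have [_ ->] := pE j; have [_ ->] := pE k; rewrite jk.
pose S := \sum_x \sum_z f x z ^+ 2.
(* Every edge is counted in both orders, which gives the factor 2. *)
have vS : 2 * (v *m v^T) 0 0 <= S.
  pose G x z := if (x < z)%O then f x z ^+ 2 else 0.
  have G0 x z : 0 <= G x z by rewrite /G; case: ifP => // _; rewrite sqr_ge0.
  apply: (@le_trans _ _ (2 * \sum_x \sum_z G x z)); last first.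
    rewrite mulr_natl mulr2n {2}exchange_big -big_split ler_sum //= => x _.
    rewrite -big_split ler_sum //= => z _; rewrite /G [f z x]fN sqrrN.
    by case: ltgtP; rewrite ?addr0 ?add0r // sqr_ge0.
  rewrite ler_pM2l ?ltr0n // pair_bigA /=.
  apply: (le_trans _ (ler_sum_injective pinj _)) => [|u]; last exact: G0.
  rewrite mxE ler_sum // => j _; have [lj jE] := pE j.
  by rewrite [v^T _ _]mxE -expr2 /G lj (vE j _ _ lj jE).
pose h x z u := (f x z + f z u + f u x) ^+ 2.
have h0 x z u : 0 <= h x z u by apply: sqr_ge0.
have hE : ((v *m (delta1 R F)^T) *m (v *m (delta1 R F)^T)^T) 0 0 =
    \sum_i h (a i) (b i) (c i).
  set q := v *m (delta1 R F)^T; rewrite mxE; apply: eq_bigr => i _.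
  rewrite [q^T _ _]mxE -expr2; congr (_ ^+ 2); rewrite mxE.
  have sel k : \sum_j v 0 j * (j == k)%:R = v 0 k.
    rewrite (bigD1 k) //= eqxx mulr1 big1 ?addr0 // => j /negPf->.
    by rewrite mulr0.
  under eq_bigr do rewrite [(_^T) _ _]mxE dE mulrBr mulrDr.
  rewrite sumrB big_split /= !sel (vE _ _ _ (ltab i) (abE i)).
  by rewrite (vE _ _ _ (ltbc i) (bcE i)) (vE _ _ _ (ltac i) (acE i)) [f (c i) _]fN.
pose wB x : R := (x \in B)%:R.
(* [k] discards the triples inside [B], the only ones that may be missing from [F]. Its sum is thus
   controlled by the members of [F], each counted six times. *)
pose k x z u := h x z u - wB x * wB z * wB u * h x z u.
have k01 x z u : 0 <= k x z u <= h x z u.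
  rewrite /k /wB; do 3!case: (_ \in B);
    by rewrite ?(mulr0, mul0r, mul1r, subrr, subr0) ?lexx ?h0.
have hk : \sum_x \sum_z \sum_u k x z u <= 6 * \sum_i h (a i) (b i) (c i).
  rewrite sum_sym3; last 3 first.
  - by move=> x z u; rewrite /k /h [f z x]fN [f x u]fN [f u z]fN; ring.
  - by move=> x z u; rewrite /k /h [f z x]fN [f x u]fN [f u z]fN; ring.
  - move=> x u; have f0 : f x x = 0 by have := fN x x; lra.
    by rewrite /k /h [f u x]fN f0; ring.
  rewrite -[leLHS]mulr_natl ler_pM2l ?ltr0n //.
  under eq_bigr do rewrite pair_bigA /=.
  rewrite pair_bigA /=.
  apply: le_trans (ler_sum_cover (p := fun i => (a i, (b i, c i))) _ _) _ => /=.
  - by move=> u; case: ifP => // _; case/andP: (k01 u.1 u.2.1 u.2.2).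
  - move=> [x [z u]] /=; case: ifP => [xzu kn|_]; last by rewrite eqxx.
    have /(nthP fset0)[m mF mE] : [fset x; z; u] \in enum_fset F.
      apply: FB => //; apply: contra kn => /and3P[xB zB uB].
      by rewrite /k /wB xB zB uB !mul1r subrr.
    exists (Ordinal mF); have := TE (Ordinal mF); rewrite /= mE => /esym/eqP.
    case/andP: xzu => xz zu; rewrite fset3_eq //.
    by case/and3P => /eqP-> /eqP-> /eqP->.
  - by apply: ler_sum => i _; case: ifP => // _; case/andP: (k01 (a i) (b i) (c i)).
(* Apply the identity with weight 1, where the divergence term vanishes, and with the indicator of
   [B]. In the difference the divergence term of [B] appears with a favourable sign and is
   dropped. *)
have kS : 3 * (n%:R - #|B|%:R) * S <= \sum_x \sum_z \sum_u k x z u.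
  have H1 := weighted_triangle_sum (fun=> 1) fN.
  have HB := weighted_triangle_sum wB fN.
  have -> : \sum_x \sum_z \sum_u k x z u =
      \sum_x \sum_z \sum_u 1 * 1 * 1 * h x z u -
      \sum_x \sum_z \sum_u wB x * wB z * wB u * h x z u.
    rewrite -sumrB; apply: eq_bigr => x _; rewrite -sumrB; apply: eq_bigr => z _.
    by rewrite -sumrB; apply: eq_bigr => u _; rewrite !mul1r.
  rewrite H1 HB.
  have -> : \sum_(x < n) 1 = n%:R :> R by rewrite sumr_const card_ord.
  have -> : \sum_x wB x = #|B|%:R.
    by rewrite /wB -natr_sum -sum1_card [in RHS]big_mkcond.
  have -> : \sum_x \sum_z 1 * 1 * f x z ^+ 2 = S.
    by apply: eq_bigr => x _; apply: eq_bigr => z _; rewrite !mul1r.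
  rewrite [\sum_z 1 * _]big1 => [|z _]; last first.
    by rewrite mul1r (eq_bigr (f^~ z)) ?div0 ?expr0n // => x _; rewrite mul1r.
  have SB : \sum_x \sum_z wB x * wB z * f x z ^+ 2 <= S.
    apply: ler_sum => x _; apply: ler_sum => z _; rewrite /wB.
    by do 2!case: (_ \in B); rewrite ?(mulr0, mul0r, mul1r) ?lexx ?sqr_ge0.
  have D0 : 0 <= \sum_z wB z * (\sum_x wB x * f x z) ^+ 2.
    by apply: sumr_ge0 => z _; rewrite mulr_ge0 ?sqr_ge0 // ler0n.
  have := ler_wpM2l (ler0n R #|B|) SB.
  lra.
have nB : 0 <= n%:R - #|B|%:R :> R.
  by rewrite subr_ge0 ler_nat -[leqRHS]card_ord max_card.
have := ler_wpM2l nB vS; rewrite hE; lra.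
Qed.

Lemma lambda_ge_of_missing (R : realType) (n : nat) (F : {fset {fset 'I_n}})
    (B : {set 'I_n}) :
  three_uniform F -> (0 < #|` F|)%N ->
  (forall x y z : 'I_n, (x < y < z)%N ->
     ~~ [&& x \in B, y \in B & z \in B] -> [fset x; y; z] \in F) ->
  n%:R - #|B|%:R <= lambda R F.
Proof.
move=> F3 F0 FB; have [[l0 le] _] := lambda_spec R F3 F0.
apply: pos_eigenvalue_gram_ge l0 le => y.
exact: delta1_row_space_ge.
Qed.

(** * Families of prescribed size *)

Lemma exists_set_between (T : finType) (A C : {set T}) (t : nat) :
  A \subset C -> (#|A| <= t <= #|C|)%N ->
  exists X : {set T}, [/\ A \subset X, X \subset C & #|X| = t].
Proof.
move=> AC /andP[At tC].
have AC' : (#|C :\: A| = #|C| - #|A|)%N by rewrite cardsD (finset.setIidPr AC).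
have : (0 < #|[set Y : {set T} | Y \subset C :\: A & #|Y| == (t - #|A|)%N]|)%N.
  by rewrite cards_draws bin_gt0 AC' leq_sub2r.
case/card_gt0P => Y; rewrite inE finset.subsetD => /andP[/andP[YC YA] /eqP Yt].
exists (A :|: Y); rewrite finset.subsetUl finset.subUset AC YC; split=> //.
by rewrite cardsU disjoint_setI0 1?disjoint_sym // cards0 subn0 Yt subnKC.
Qed.

(** Carries the counting results for [{set T}] over to the [{fset T}] used by [lambda]. *)
Definition fset_of_set (T : finType) (A : {set T}) : {fset T} := [fset x in A].

Lemma in_fset_of_set (T : finType) (A : {set T}) x :
  (x \in fset_of_set A) = (x \in A).
Proof. by rewrite !inE. Qed.

Lemma fset_of_set_inj (T : finType) : injective (@fset_of_set T).
Proof.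
by move=> A B /fsetP AB; apply/setP => x; rewrite -!in_fset_of_set AB.
Qed.

Lemma card_fset_of_set (T : finType) (A : {set T}) : #|` fset_of_set A| = #|A|.
Proof. by rewrite card_imfset //= cardE. Qed.

Lemma phi_ge (R : realType) (a m t : nat) : (0 < t)%N ->
  ('C(a + m, 3) <= t + 'C(m, 3))%N -> (t <= 'C(a + m, 3))%N -> a%:R <= phi R t.
Proof.
move=> t0 tlo thi.
pose B := [set x : 'I_(a + m) | (a <= x)%N]%SET.
have cB : #|B| = m.
  have -> : B = @rshift a m @: [set: 'I_m]%SET.
    apply/setP => x; rewrite inE; apply/idP/imsetP => [ax|[y _ ->]].
      have xm : (x - a < m)%N by have := ltn_ord x; lia.
      by exists (Ordinal xm) => //; apply: val_inj; rewrite /= subnKC.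
    by rewrite /= leq_addr.
  by rewrite card_imset ?cardsT ?card_ord //; apply: rshift_inj.
pose U := [set A : {set 'I_(a + m)} | #|A| == 3%N]%SET.
pose UB := [set A : {set 'I_(a + m)} | A \subset B & #|A| == 3%N]%SET.
have cU : #|U| = 'C(a + m, 3) by rewrite card_draws card_ord.
have cUB : #|UB| = 'C(m, 3) by rewrite cards_draws cB.
have UBU : UB \subset U by apply/fintype.subsetP => A; rewrite !inE => /andP[].
have cD : #|U :\: UB| = ('C(a + m, 3) - 'C(m, 3))%N.
  by rewrite cardsD (finset.setIidPr UBU) cU cUB.
(* All triples not inside [B] are forced in; triples inside [B] are added until the size is [t]. *)
have [X [DX XU Xt]] : exists X : {set {set 'I_(a + m)}},
    [/\ U :\: UB \subset X, X \subset U & #|X| = t].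
  by apply: exists_set_between; rewrite ?finset.subsetDl // cD cU; lia.
pose F := [fset fset_of_set A | A in X].
have FE : #|` F| = t.
  by rewrite card_imfset /=; [rewrite -cardE|exact: fset_of_set_inj].
have F3 : three_uniform F.
  move=> T /imfsetP[A /= AX ->]; rewrite card_fset_of_set.
  by have := fintype.subsetP XU _ AX; rewrite inE => /eqP.
rewrite -FE; apply: le_trans (lambda_le_phi R F3).
have -> : a%:R = (a + m)%:R - #|B|%:R :> R by rewrite cB natrD addrK.
apply: lambda_ge_of_missing => //; first by rewrite FE.
move=> x y z /andP[xy yz] nB.
apply/imfsetP; exists [set x; y; z]%SET => /=; last first.
  by apply/fsetP => u; rewrite in_fset_of_set !inE.
apply: (fintype.subsetP DX).
have c3 : #|[set x; y; z]%SET| = 3%N.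
  rewrite finset.setUC cardsU1 cards2 !inE.
  have /negPf-> : z != x by rewrite neq_ltn (ltn_trans xy yz) orbT.
  have /negPf-> : z != y by rewrite neq_ltn yz orbT.
  by have -> : x != y by rewrite neq_ltn xy.
rewrite !inE c3 eqxx !andbT; apply: contra nB => /fintype.subsetP sub.
by rewrite !sub // !inE eqxx ?orbT.
Qed.

(** * Binomial estimates: every large size is reached *)

Lemma bin3E (k : nat) : ('C(k.+3, 3) * 6 = k.+3 * k.+2 * k.+1)%N.
Proof. by rewrite -[6%N]/(3`!) bin_ffact !ffactnS ffactn0 /=; lia. Qed.

Lemma bin2E (k : nat) : ('C(k.+2, 2) * 2 = k.+2 * k.+1)%N.
Proof. by rewrite -[X in (_ * X)%N]/(2`!) bin_ffact !ffactnS ffactn0 /=; lia. Qed.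

(* With [m = j + 6] the difference of the two sides is at least
   [j * (j + 1) * (j + 5) / 6]. *)
Lemma bin_gap_covered (a m : nat) : (3 <= a)%N -> (a + 3 <= m)%N ->
  ('C(a + m, 2) <= 'C(m.+1, 3) + 1)%N.
Proof.
move=> a3 am.
have [j mE] : exists j, m = (j + 6)%N by exists (m - 6)%N; lia.
(* The worst case is [a = m - 3 = j + 3], where [a + m = 2 * j + 9]. *)
apply: (@leq_trans 'C((2 * j + 7).+2, 2)); first by apply: leq_bin2l; lia.
have := bin2E (2 * j + 7); have := bin3E (j + 4).
have -> : (j + 4).+3 = m.+1 by lia.
nia.
Qed.

(** Take the least [m >= a + 3] with [t <= 'C(a + m, 3)]. If [m = a + 3], the lower bound on [t]
    gives the other inequality; otherwise minimality, Pascal's rule and [bin_gap_covered] do. *)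
Lemma exists_bin_window (a t : nat) : (3 <= a)%N ->
  (2 * a ^ 3 + 2 * a ^ 2 + 1 <= t)%N ->
  exists m, ('C(a + m, 3) <= t + 'C(m, 3))%N /\ (t <= 'C(a + m, 3))%N.
Proof.
move=> a3 at_.
have ex : exists k, (t <= 'C(a + (a + 3 + k), 3))%N.
  exists t; have -> : (a + (a + 3 + t) = (2 * a + t).+3)%N by lia.
  have : (6 * (2 * a + t).+1 <= (2 * a + t).+3 * (2 * a + t).+2 * (2 * a + t).+1)%N.
    by rewrite leq_mul2r; apply/orP; right; nia.
  by rewrite -bin3E; lia.
case: (ex_minnP ex) => k kt kmin; exists (a + 3 + k)%N; split=> //.
case: k kt kmin => [_ _|k kt kmin].
  have := bin3E (2 * a); have := bin3E a.
  have -> : (a + (a + 3 + 0) = (2 * a).+3)%N by lia.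
  have -> : (a + 3 + 0 = a.+3)%N by lia.
  nia.
(* This strict inequality absorbs the [+ 1] in [bin_gap_covered]. *)
have lt : ('C(a + (a + 3 + k), 3) < t)%N.
  by rewrite ltnNge; apply/negP => /kmin; rewrite ltnn.
have := @bin_gap_covered a (a + 3 + k) a3 (leq_addr _ _).
rewrite (addnS (a + 3) k) (addnS a (a + 3 + k)) (binS (a + (a + 3 + k)) 2); lia.
Qed.

Lemma phi_ge_nat (R : realType) (a t : nat) : (3 <= a)%N ->
  (2 * a ^ 3 + 2 * a ^ 2 + 1 <= t)%N -> a%:R <= phi R t.
Proof.
move=> a3 at_; have [m [tlo thi]] := exists_bin_window a3 at_.
by apply: phi_ge tlo thi; lia.
Qed.

(** * Cube roots and the asymptotic order of phi *)

Lemma cbrtK (R : realType) (x : R) : 0 <= x -> (x `^ 3^-1) ^+ 3 = x.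
Proof.
by move=> x0; rewrite -powR_mulrn ?powR_ge0 // -powRrM mulVf ?powRr1.
Qed.

Lemma ler_cube (R : realDomainType) (x y : R) : 0 <= x -> 0 <= y ->
  x ^+ 3 <= y ^+ 3 -> x <= y.
Proof. by move=> x0 y0; rewrite ler_pXn2r. Qed.

(** For [t >= 81] the floor [a] is at least 3, and [t >= 3 * a ^ 3 >= 2 * a ^ 3 + 2 * a ^ 2 + 1]
    because [a ^ 3 >= 2 * a ^ 2 + 1] for [a >= 3]. *)
Lemma phi_ge_floor (R : realType) (t : nat) : (81 <= t)%N ->
  (Num.floor ((t%:R / 3) `^ 3^-1 : R))%:~R <= phi R t.
Proof.
move=> t81; set x := _ `^ _.
have t3 : 0 <= t%:R / 3 :> R by rewrite divr_ge0.
have x0 : 0 <= x := powR_ge0 _ _.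
have x3 : x ^+ 3 = t%:R / 3 := cbrtK t3.
have t81' : 81 <= t%:R :> R by rewrite (ler_nat _ 81).
have xge3 : 3 <= x by apply: ler_cube => //; rewrite x3; lra.
have : 3 <= Num.floor x by rewrite floor_ge_int.
case fE : (Num.floor x) => [a|//] a3.
have ax : a%:R <= x by have := ge_floor x; rewrite fE.
have ax3 : a%:R ^+ 3 <= t%:R / 3 :> R by rewrite -x3 lerXn2r ?nnegrE.
have : (3 * a ^ 3 <= t)%N.
  by rewrite -(ler_nat R) natrM natrX; lra.
move=> h; apply: phi_ge_nat; first by lia.
nia.
Qed.

Theorem theorem3p25 (R : realType) :
  [/\ forall a t : nat, (3 <= a)%N -> (2 * a ^ 3 + 2 * a ^ 2 + 1 <= t)%N ->
        a%:R <= phi R t,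
      forall t : nat, (81 <= t)%N ->
        (Num.floor ((t%:R / 3) `^ 3^-1 : R))%:~R <= phi R t
    & phi R =Theta_\oo (fun t : nat => t%:R `^ 3^-1)].
Proof.
split; [exact: phi_ge_nat|exact: phi_ge_floor|].
(* The upper constant 3 is the cube root of 27 in [phi_ge0_cube_le]; the lower constant 1/3 leaves
   room for the floor. *)
rewrite eqThetaE qualifE; apply/asboolP; exists (3^-1, 3) => /=.
  by rewrite invr_gt0 !ltr0n.
exists 81%N => // t /= t81.
have [p0 p3] := phi_ge0_cube_le R (leq_trans (isT : 0 < 81)%N t81).
have c0 : 0 <= t%:R `^ 3^-1 :> R := powR_ge0 _ _.
have c3 := cbrtK (ler0n R t).
set c := _ `^ _ in c0 c3 *.
rewrite !ger0_norm //; split; last first.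
  by apply: ler_cube; rewrite ?mulr_ge0 // exprMn c3; lra.
apply: le_trans (phi_ge_floor R t81); set x := _ `^ _.
have t3 : 0 <= t%:R / 3 :> R by rewrite divr_ge0.
have x0 : 0 <= x := powR_ge0 _ _.
have x3 : x ^+ 3 = t%:R / 3 := cbrtK t3.
have t81' : 81 <= t%:R :> R by rewrite (ler_nat _ 81).
have xge3 : 3 <= x by apply: ler_cube => //; rewrite x3; lra.
(* Since [c^3 = 3 x^3 <= 8 x^3]. As [x >= 3], the floor of [x] exceeds [x - 1 >= 2x/3 >= c/3]. *)
have cx : c <= 2 * x.
  by apply: ler_cube; rewrite ?mulr_ge0 // exprMn x3 c3; lra.
have := floorD1_gt x; rewrite intrD; lra.
Qed.
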